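(* Let $n\in\mathbb{N}$, let $S$ be a finite set, and let $f:S^n\to[-1,1]$ be a function. Let $X_1,\ldots,X_n$ be $n$ pairwise independent random variables taking values in $S$, and let $X=(X_1,\ldots,X_n)$. Then for all positive $\alpha,p\in\mathbb{R}$, $$K(f,X,p,\alpha)<\frac{8}{p\alpha^2}.$$
   Context: Write $[n]=\{1,\ldots,n\}$ and write $f$ for the random variable $f(X)=f(X_1,\ldots,X_n)$. The random variables $X_1,\ldots,X_n$ are pairwise independent if for all $i\neq j$ the variables $X_i,X_j$ are independent (they need not be identically distributed). For $p,\alpha\in\mathbb{R}$, the player $X_i$ (index $i\in[n]$) is called $(p,\alpha)$-pivotal in $f$ with respect to $X$ if $$\Pr_{X_i}\Big[\big|\mathbb{E}[f\mid X_i]-\mathbb{E}[f]\big|>\alpha\Big]>p.$$ $K(f,X,p,\alpha)$ denotes the number of indices $i\in[n]$ such that $X_i$ is $(p,\alpha)$-pivotal in $f$ with respect to $X$. *)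

(* Defs.v *)
From HB Require Import structures.
From mathcomp Require Import all_boot all_order all_algebra.
From mathcomp Require Import all_classical all_reals all_analysis.

Set Implicit Arguments.
Unset Strict Implicit.
Unset Printing Implicit Defensive.

Import Order.TTheory GRing.Theory Num.Theory.
Import numFieldNormedType.Exports.

Local Open Scope classical_set_scope.
Local Open Scope ring_scope.

(* The finite set S carries the discrete sigma-algebra: every subset is
   measurable. *)
Definition discrete_rv d (T : measurableType d) (S : finType) (X : T -> S) :=
  forall A : set S, measurable (X @^-1` A).

Definition independent_rv2 d (T : measurableType d) (R : realType)
    (P : probability T R) (S : finType) (X Y : T -> S) :=
  forall A B : set S,
    P (X @^-1` A `&` Y @^-1` B) = (P (X @^-1` A) * P (Y @^-1` B))%E.

Definition pairwise_independent d (T : measurableType d) (R : realType)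
    (P : probability T R) (S : finType) (n : nat) (X : 'I_n -> T -> S) :=
  forall i j : 'I_n, i != j -> independent_rv2 P (X i) (X j).

Definition mean d (T : measurableType d) (R : realType)
    (P : probability T R) (Z : T -> R) : R := fine 'E_P[Z].

(* E[Z | Y] for a finitely-valued Y, as a random variable on T: at w it is
   E[Z 1_{Y = Y w}] / P(Y = Y w). On the null event where P(Y = Y w) = 0 the
   quotient is 0 because 0^-1 = 0; this is one version of E[Z | Y]. *)
Definition cond_mean d (T : measurableType d) (R : realType)
    (P : probability T R) (S : finType) (Z : T -> R) (Y : T -> S) (w : T) : R :=
  let A := Y @^-1` [set Y w] in
  mean P (fun t => Z t * \1_A t) / fine (P A).

Definition joint (T : Type) (S : finType) (n : nat) (X : 'I_n -> T -> S)
    (w : T) : {ffun 'I_n -> S} := [ffun i => X i w].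

Definition pivotal d (T : measurableType d) (R : realType)
    (P : probability T R) (S : finType) (n : nat)
    (f : {ffun 'I_n -> S} -> R) (X : 'I_n -> T -> S) (p alpha : R)
    (i : 'I_n) : bool :=
  let Z := f \o joint X in
  (p%:E < P [set w | (alpha < `|cond_mean P Z (X i) w - mean P Z|)%R])%E.

Definition K d (T : measurableType d) (R : realType)
    (P : probability T R) (S : finType) (n : nat)
    (f : {ffun 'I_n -> S} -> R) (X : 'I_n -> T -> S) (p alpha : R) : nat :=
  #|[pred i | pivotal P f X p alpha i]|.

(* Main.v *)
Require Import Defs.
From mathcomp Require Import all_boot all_order all_algebra.
From mathcomp Require Import all_classical all_reals all_analysis.
From mathcomp Require Import ring lra.

(** Write [v_i] for the variance of [g_i = E[f | X_i] - E[f]].  An index is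
    pivotal when [g_i] exceeds [alpha] in absolute value with probability more
    than [p], and then Markov's inequality for [g_i ^ 2] gives
    [v_i > p alpha^2].  So it suffices to bound the sum of the [v_i].

    Each [g_i] is centred and is a function of [X_i] alone, so pairwise
    independence makes the [g_i] pairwise orthogonal in L^2.  The defining
    property of conditional expectation gives [E[f g_i] = E[g_i ^ 2]], that is,
    [g_i] is the orthogonal projection of [f] on the span of [g_i].
    Bessel's inequality then says that the sum of the [v_i] is at most
    [E[f ^ 2] <= 1].  Hence [K p alpha^2 <= 1], which is stronger than the
    stated bound.

    All the expectations involved are expectations of functions of the vector
    [X], which has finitely many values.  The argument is therefore carried out
    with finite sums weighted by the law of [X] ([fexp_bessel],
    [fexp_markov_sqr], [fexp_influence]); the lemmas [mean_law], [prob_law] and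
    [cond_mean_law] translate the measure-theoretic quantities into such
    sums. *)

Import Order.TTheory GRing.Theory Num.Theory.

Local Open Scope ring_scope.

(** * Expectation with respect to finitely many weights *)

Definition fexp {R : realType} {U : finType} (q h : U -> R) : R :=
  \sum_u q u * h u.

(** At a value [s] of total weight 0 the quotient is 0, in accordance with
    [cond_mean]. *)
Definition fcond {R : realType} {U S : finType} (q h : U -> R) (Y : U -> S)
    (s : S) : R :=
  (\sum_(u | Y u == s) q u * h u) / (\sum_(u | Y u == s) q u).

Section FiniteExpectation.
Set Implicit Arguments.
Unset Strict Implicit.
Context {R : realType} {U : finType} (q : U -> R).

Lemma eq_fexp (g h : U -> R) : g =1 h -> fexp q g = fexp q h.
Proof. by move=> gh; apply: eq_bigr => u _; rewrite gh. Qed.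

Lemma fexpD (g h : U -> R) :
  fexp q (fun u => g u + h u) = fexp q g + fexp q h.
Proof. by rewrite -big_split; apply: eq_bigr => u _; rewrite mulrDr. Qed.

Lemma fexpZ (c : R) (h : U -> R) : fexp q (fun u => c * h u) = c * fexp q h.
Proof. by rewrite /fexp mulr_sumr; apply: eq_bigr => u _; rewrite mulrCA. Qed.

Lemma fexp_sum (I : finType) (A : pred I) (h : I -> U -> R) :
  fexp q (fun u => \sum_(i | A i) h i u) = \sum_(i | A i) fexp q (h i).
Proof.
by rewrite /fexp exchange_big /=; apply: eq_bigr => u _; rewrite mulr_sumr.
Qed.

(** The defining property of conditional expectation: group the points by the
    value of [Y], on which [phi (Y u)] is constant. *)
Lemma fexp_fcond (q_ge0 : forall u, 0 <= q u) (S : finType) (Y : U -> S)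
    (h : U -> R) (phi : S -> R) :
  fexp q (fun u => h u * phi (Y u)) =
  fexp q (fun u => fcond q h Y (Y u) * phi (Y u)).
Proof.
rewrite /fexp (partition_big Y xpredT) //= [RHS](partition_big Y xpredT) //=.
apply: eq_bigr => s _.
transitivity (phi s * \sum_(u | Y u == s) q u * h u).
  by rewrite mulr_sumr; apply: eq_bigr => u /eqP ->; rewrite mulrA mulrC.
transitivity (phi s * (fcond q h Y s * \sum_(u | Y u == s) q u)); last first.
  by rewrite !mulr_sumr; apply: eq_bigr => u /eqP ->; ring.
congr (_ * _); rewrite /fcond.
have [q0|qn0] := eqVneq (\sum_(u | Y u == s) q u) 0; last by rewrite divfK.
(* The quotient is then 0, and so is the numerator: a sum of nonnegative
   weights vanishes only termwise. *)
rewrite q0 invr0 !mulr0; apply: big1 => u Yu.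
by rewrite (psumr_eq0P _ q0) ?mul0r.
Qed.

(** Independence is assumed for pairs of single values, which suffices because
    both sides are linear combinations of point probabilities. *)
Lemma fexp_indep (S : finType) (Y1 Y2 : U -> S) (phi psi : S -> R) :
  (forall s t, \sum_(u | (Y1 u == s) && (Y2 u == t)) q u =
     (\sum_(u | Y1 u == s) q u) * (\sum_(u | Y2 u == t) q u)) ->
  fexp q (fun u => phi (Y1 u) * psi (Y2 u)) =
  fexp q (fun u => phi (Y1 u)) * fexp q (fun u => psi (Y2 u)).
Proof.
move=> ind.
have marg (Y : U -> S) (chi : S -> R) :
    fexp q (fun u => chi (Y u)) = \sum_s (\sum_(u | Y u == s) q u) * chi s.
  rewrite /fexp (partition_big Y xpredT) //=; apply: eq_bigr => s _.
  by rewrite mulr_suml; apply: eq_bigr => u /eqP ->.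
rewrite !marg big_distrlr /= /fexp (partition_big Y1 xpredT) //=.
apply: eq_bigr => s _; rewrite (partition_big Y2 xpredT) //=.
apply: eq_bigr => t _.
rewrite mulrACA -ind mulr_suml; apply: eq_bigr => u /andP[/eqP -> /eqP ->].
by [].
Qed.

(** Bessel's inequality, from [E[(f - G)^2] >= 0] with [G] the sum of the
    [g i]: orthogonality and the projection hypothesis give both [E[f G]] and
    [E[G ^ 2]] the value [v] of the left-hand side.  The projection hypothesis takes
    the place of the usual normalisation of the [g i]. *)
Lemma fexp_bessel (q_ge0 : forall u, 0 <= q u) (I : finType) (A : pred I)
    (f : U -> R) (g : I -> U -> R) :
  (forall i j, i != j -> fexp q (fun u => g i u * g j u) = 0) ->
  (forall i, fexp q (fun u => f u * g i u) = fexp q (fun u => g i u ^+ 2)) ->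
  \sum_(i | A i) fexp q (fun u => g i u ^+ 2) <= fexp q (fun u => f u ^+ 2).
Proof.
move=> orth proj; set v := (X in X <= _).
pose G u := \sum_(i | A i) g i u.
have fG : fexp q (fun u => f u * G u) = v.
  transitivity (fexp q (fun u => \sum_(i | A i) f u * g i u)).
    by apply: eq_fexp => u; rewrite mulr_sumr.
  by rewrite fexp_sum; apply: eq_bigr => i _; exact: proj.
have GG : fexp q (fun u => G u ^+ 2) = v.
  transitivity (fexp q (fun u => \sum_(i | A i) \sum_(j | A j) g i u * g j u)).
    by apply: eq_fexp => u; rewrite expr2 big_distrlr.
  rewrite fexp_sum; apply: eq_bigr => i Ai; rewrite fexp_sum (bigD1 i) //=.
  rewrite [X in _ + X]big1 ?addr0 // => j /andP[_ ji].
  by rewrite orth // eq_sym.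
have : 0 <= fexp q (fun u => (f u - G u) ^+ 2).
  by apply: sumr_ge0 => u _; rewrite mulr_ge0 // sqr_ge0.
have -> : fexp q (fun u => (f u - G u) ^+ 2) =
    fexp q (fun u => f u ^+ 2) + (- 2 * v + v).
  rewrite -{1}fG -{1}GG -fexpZ -!fexpD.
  by apply: eq_fexp => u; ring.
by move=> ?; lra.
Qed.

(** The strict inequality comes from the hypothesis on [p]; the bound
    [alpha^2 P(|g| > alpha) <= E[g^2]] itself is Markov's. *)
Lemma fexp_markov_sqr (q_ge0 : forall u, 0 <= q u) (g : U -> R) (p alpha : R) :
  0 < alpha -> p < \sum_(u | alpha < `|g u|) q u ->
  p * alpha ^+ 2 < fexp q (fun u => g u ^+ 2).
Proof.
move=> a0 pq.
apply: (@lt_le_trans _ _ ((\sum_(u | alpha < `|g u|) q u) * alpha ^+ 2)).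
  by rewrite ltr_pM2r // exprn_gt0.
rewrite mulr_suml /fexp [leRHS](bigID (fun u => alpha < `|g u|)) /=.
rewrite -[leLHS]addr0; apply: lerD; last first.
  by apply: sumr_ge0 => u _; rewrite mulr_ge0 ?sqr_ge0.
apply: ler_sum => u au; apply: ler_wpM2l => //.
rewrite -[g u ^+ 2]real_normK ?num_real //.
by rewrite lerXn2r ?nnegrE ?(ltW au) ?(ltW a0).
Qed.

(** The centred conditional expectations are orthogonal, since independent
    centred variables are, and each of them satisfies the projection hypothesis
    of Bessel's inequality because subtracting the constant [E[f]] does not
    change the product with a centred variable. *)
Lemma fexp_influence (q_ge0 : forall u, 0 <= q u)
    (q1 : \sum_u q u = 1) (I S : finType) (Y : I -> U -> S)
    (f : U -> R) (A : pred I) :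
  (forall i j, i != j -> forall s t,
     \sum_(u | (Y i u == s) && (Y j u == t)) q u =
     (\sum_(u | Y i u == s) q u) * (\sum_(u | Y j u == t) q u)) ->
  \sum_(i | A i) fexp q (fun u => (fcond q f (Y i) (Y i u) - fexp q f) ^+ 2) <=
  fexp q (fun u => f u ^+ 2).
Proof.
move=> ind; set m := fexp q f.
pose g i u := fcond q f (Y i) (Y i u) - m.
have fexp_cst c : fexp q (fun=> c) = c by rewrite /fexp -mulr_suml q1 mul1r.
have g0 i : fexp q (g i) = 0.
  rewrite fexpD fexp_cst -[RHS](subrr m); congr (_ - _).
  transitivity (fexp q (fun u => fcond q f (Y i) (Y i u) * 1)).
    by apply: eq_fexp => u; rewrite mulr1.
  rewrite -(fexp_fcond q_ge0 (Y i) f (fun=> 1)).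
  by apply: eq_fexp => u; rewrite mulr1.
apply: (@fexp_bessel q_ge0 _ _ f g) => [i j ij|i].
- rewrite (fexp_indep (fun s => fcond q f (Y i) s - m)
    (fun s => fcond q f (Y j) s - m) (ind i j ij)).
  by rewrite [X in X * _](g0 i) mul0r.
- rewrite (fexp_fcond q_ge0 (Y i) f (fun s => fcond q f (Y i) s - m)).
  transitivity (fexp q (fun u => g i u ^+ 2) + m * fexp q (g i)).
    by rewrite -fexpZ -fexpD; apply: eq_bigr => u _; rewrite /g; ring.
  by rewrite g0 mulr0 addr0.
Qed.

End FiniteExpectation.

(** * The law of a random variable with finitely many values *)

Local Open Scope classical_set_scope.

Section Law.
Set Implicit Arguments.
Unset Strict Implicit.
Context {R : realType} {d : measure_display} {T : measurableType d}
  (P : probability T R).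

Definition law {U : finType} (W : T -> U) (u : U) : R :=
  fine (P (W @^-1` [set u])).

Lemma law_ge0 (U : finType) (W : T -> U) (u : U) : 0 <= law W u.
Proof. exact/fine_ge0/measure_ge0. Qed.

(** [h \o W] is the linear combination of the indicators of the events
    [W = u], with coefficients [h u]. *)
Lemma mean_law (U : finType) (W : T -> U) (h : U -> R) :
  discrete_rv W -> mean P (h \o W) = fexp (law W) h.
Proof.
move=> mW; rewrite /mean unlock.
have ind u : P.-integrable setT (fun t => (\1_(W @^-1` [set u]) t)%:E).
  exact: integrable_indic.
transitivity (fine (\int[P]_t
    (\sum_(u : U) (h u)%:E * (\1_(W @^-1` [set u]) t)%:E)%E)%E).
  congr fine; apply: eq_integral => t _.
  rewrite (bigD1 (W t)) //= indicE mem_set // mule1.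
  rewrite big1 ?adde0 // => u uW; rewrite indicE memNset ?mule0 //.
  by move=> /= Wtu; rewrite Wtu eqxx in uW.
rewrite integral_sum //; last by move=> u; exact: integrableZl.
rewrite (eq_bigr (fun u => (law W u * h u)%:E)); last first.
  move=> u _; rewrite integralZl // integral_indic // setIT.
  rewrite mulrC EFinM /law fineK //; exact: fin_num_measure.
by rewrite sumEFin.
Qed.

Lemma prob_law (U : finType) (W : T -> U) (A : pred U) :
  discrete_rv W -> fine (P [set t | A (W t)]) = \sum_(u | A u) law W u.
Proof.
move=> mW.
have mA : measurable [set t | A (W t)] by exact: (mW [set u | A u]).
rewrite -(expectation_indic P mA) -/(mean P _).
rewrite (_ : \1__ = (fun u => (A u)%:R) \o W); last first.
  by apply/funext => t; rewrite indicE mem_setE.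
rewrite mean_law // /fexp [RHS]big_mkcond; apply: eq_bigr => u _.
by case: (A u); rewrite ?mulr1 ?mulr0.
Qed.

(** Events about the joint variable are finite unions of finite intersections
    of events about the components. *)
Lemma discrete_joint (S : finType) (n : nat) (X : 'I_n -> T -> S) :
  (forall i, discrete_rv (X i)) -> discrete_rv (joint X).
Proof.
move=> mX A.
have -> : joint X @^-1` A =
    \bigcup_(x in A) \bigcap_(i in [set: 'I_n]) (X i @^-1` [set x i]).
  rewrite eqEsubset; split => [t At|t [x Ax Xx]].
    by exists (joint X t) => // i _ /=; rewrite ffunE.
  rewrite /preimage /= (_ : joint X t = x) //.
  by apply/ffunP => i; rewrite ffunE; exact: Xx.
apply: fin_bigcup_measurable => // x _.
by apply: fin_bigcap_measurable => // i _; exact: mX.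
Qed.

Lemma cond_mean_law (U S : finType) (W : T -> U) (h : U -> R) (Y : U -> S)
    (t : T) : discrete_rv W ->
  cond_mean P (h \o W) (Y \o W) t = fcond (law W) h Y (Y (W t)).
Proof.
move=> mW; rewrite /cond_mean /fcond; congr (_ / _).
  rewrite (_ : (fun _ => _) = (fun u => h u * (Y u == Y (W t))%:R) \o W).
    rewrite mean_law // /fexp [RHS]big_mkcond; apply: eq_bigr => u _.
    by case: eqP; rewrite ?mulr1 ?mulr0.
  apply/funext => w /=; rewrite indicE; congr (_ * _%:R).
  by congr nat_of_bool; apply/idP/eqP; rewrite inE.
rewrite -(prob_law (fun u => Y u == Y (W t))) //; congr (fine (P _)).
by apply/funext => w /=; apply/propext; split => /eqP.
Qed.

End Law.

Local Close Scope classical_set_scope.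

(** * Counting pivotal players *)

Theorem theorem2p6 (R : realType) (d : measure_display) (T : measurableType d)
    (P : probability T R) (n : nat) (S : finType)
    (f : {ffun 'I_n -> S} -> R) (hf : forall x, -1 <= f x <= 1)
    (X : 'I_n -> T -> S) (hX : forall i, discrete_rv (X i))
    (hind : pairwise_independent P X)
    (alpha p : R) (halpha : 0 < alpha) (hp : 0 < p) :
  (K P f X p alpha)%:R < 8 / (p * alpha ^+ 2).
Proof.
have mW := discrete_joint hX.
set q := law P (joint X); have q_ge0 := law_ge0 P (joint X).
pose Y (i : 'I_n) (x : {ffun 'I_n -> S}) := x i.
have XE i : X i = Y i \o joint X by apply/funext => t; rewrite /= /Y ffunE.
have q1 : \sum_u q u = 1.
  by rewrite -(prob_law P predT mW) (_ : [set _ | _]%classic = setT)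
    ?probability_setT //; apply/seteqP.
have ind i j : i != j -> forall s t,
    \sum_(u | (Y i u == s) && (Y j u == t)) q u =
    (\sum_(u | Y i u == s) q u) * (\sum_(u | Y j u == t) q u).
  move=> ij s t.
  have pre k r :
      [set w | Y k (joint X w) == r]%classic = (X k @^-1` [set r])%classic.
    by rewrite XE; apply/funext => w /=; apply/propext; split => /eqP.
  rewrite -(prob_law P (fun u => (Y i u == s) && (Y j u == t)) mW).
  rewrite -(prob_law P (fun u => Y i u == s) mW).
  rewrite -(prob_law P (fun u => Y j u == t) mW).
  rewrite !pre -fineM ?fin_num_measure //; try exact: hX.
  rewrite -hind // -!pre; congr (fine (P _)).
  by apply/funext => w /=; apply/propext; split => /andP.
pose A := [pred i | pivotal P f X p alpha i].
pose v i := fexp q (fun u => (fcond q f (Y i) (Y i u) - fexp q f) ^+ 2).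
have v_gt i : A i -> p * alpha ^+ 2 < v i.
  move=> /=; rewrite /pivotal /= => piv; apply: fexp_markov_sqr => //.
  pose big u := alpha < `|fcond q f (Y i) (Y i u) - fexp q f|.
  have mbig : measurable [set w | big (joint X w)]%classic.
    exact: (mW [set u | big u]%classic).
  rewrite -(prob_law P big mW) -lte_fin fineK ?fin_num_measure //.
  move: piv; congr (_ < P _)%E; apply/funext => w.
  by rewrite /= (mean_law P f mW) {1}XE (cond_mean_law P f (Y i) w mW).
have v_le : \sum_(i | A i) v i <= 1.
  apply: (le_trans (fexp_influence q_ge0 q1 f A ind)).
  rewrite -q1 /fexp; apply: ler_sum => u _; rewrite ler_piMr //.
  by have := hf u; nra.
have pa0 : 0 < p * alpha ^+ 2 by rewrite mulr_gt0 // exprn_gt0.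
rewrite ltr_pdivlMr //; apply: (@le_lt_trans _ _ 1); last by lra.
apply: le_trans v_le; rewrite /K -sum1_card natr_sum mulr_suml.
by apply: ler_sum => i Ai; rewrite mul1r ltW // v_gt.
Qed.
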